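(* Let $J, D\in\mathbb{R}^{d\times d}$ satisfy $J^{\mathrm T}=-J$, $D^{\mathrm T}=D$ and $JD=DJ$, let $V:\mathbb{R}^d\to\mathbb{R}$ be differentiable, and set $A=JD$ and $H(q)=\frac12 q^{\mathrm T}Dq+V(q)$. Let $\overline{\nabla}V:\mathbb{R}^d\times\mathbb{R}^d\to\mathbb{R}^d$ be a discrete gradient of $V$, i.e. $\overline{\nabla}V(q,q')\cdot(q'-q)=V(q')-V(q)$ for all $q,q'\in\mathbb{R}^d$. Then the method $$q_{k+1} = e^{Ah}q_k + \Big(\int_0^h e^{A\tau}\,d\tau\Big) J\,\overline{\nabla}V(q_k,q_{k+1})$$ preserves the Hamiltonian $H$: for every $h\in\mathbb{R}$ and all $q_k,q_{k+1}\in\mathbb{R}^d$ satisfying this equation, $H(q_{k+1})=H(q_k)$.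
   Context: The method is an energy-preserving exponential integrator with timestep $h$ for the semilinear Poisson system $\dot q = J(Dq+\nabla V(q)) = J\nabla H(q)$. It is an implicit one-step method $q_k\mapsto q_{k+1}$. Here $e^{M}$ is the matrix exponential and the dot denotes the Euclidean inner product. *)

(* Defs.v *)
From mathcomp Require Export all_boot all_order all_algebra.
From mathcomp Require Export all_classical all_reals all_analysis.

Set Implicit Arguments.
Unset Strict Implicit.
Unset Printing Implicit Defensive.

Export Order.TTheory GRing.Theory Num.Theory.
Export numFieldNormedType.Exports.

Local Open Scope classical_set_scope.
Local Open Scope ring_scope.

(* The limit is taken in the norm topology of 'M[R]_d, in which this series
   converges for every M. *)
Definition expmx (R : realType) (d : nat) (M : 'M[R]_d) : 'M[R]_d :=
  limn (series (fun n : nat => (n`!%:R)^-1 *: M ^+ n)).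

(* The limits of integration may be in either order: the integral from a to b
   is minus the integral over [b, a] when b < a. *)
Definition oint (R : realType) (a b : R) (f : R -> R) : R :=
  if a <= b then \int[lebesgue_measure]_(t in `[a, b]) f t
  else - \int[lebesgue_measure]_(t in `[b, a]) f t.

Definition ointmx (R : realType) (m n : nat) (a b : R)
    (F : R -> 'M[R]_(m, n)) : 'M[R]_(m, n) :=
  \matrix_(i < m, j < n) oint a b (fun t => F t i j).

Definition dotv (R : realType) (d : nat) (u v : 'cV[R]_d) : R :=
  \sum_(i < d) u i 0 * v i 0.

Definition discrete_gradient (R : realType) (d : nat) (V : 'cV[R]_d -> R)
    (G : 'cV[R]_d -> 'cV[R]_d -> 'cV[R]_d) : Prop :=
  forall q q' : 'cV[R]_d, dotv (G q q') (q' - q) = V q' - V q.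

Definition hamiltonian (R : realType) (d : nat) (D : 'M[R]_d)
    (V : 'cV[R]_d -> R) (q : 'cV[R]_d) : R :=
  2^-1 * (q^T *m D *m q) 0 0 + V q.

(* Main.v *)
(* Write E(t) = e^{tA} and P(t) = \int_0^t E. Both solve linear matrix ODEs, so
   every identity between them follows by checking that a matrix curve has zero
   derivative and comparing values at t = 0: A P = E - 1, E^T E = 1 and
   E P^T = P (A is skew because J and D commute), and E, P commute with J.
   With g the discrete gradient and w = D q_k + g, the scheme then reads
   q_{k+1} = q_k + z with z = P J w, and
     2 (H(q_{k+1}) - H(q_k)) = z^T D z + 2 w^T z = w^T ((P + P^T) J) w,
   which vanishes because (P + P^T) J is skew-symmetric. *)

Require Import Defs.
From mathcomp Require Import ring.
Local Open Scope classical_set_scope.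
Local Open Scope ring_scope.

Set Implicit Arguments.
Unset Strict Implicit.

(** * Power series dominated by an exponential series *)

Section ExponentialGrowth.
Variable R : realType.
Implicit Types c : R^nat.

(* Requiring 1 <= C makes the bound stable under integrating the power series. *)
Definition exp_growth c := exists K C : R,
  [/\ 0 <= K, 1 <= C & forall n, `|c n| <= K * (C ^+ n / n`!%:R)].

Lemma exp_growth_pseries_cvg c x : exp_growth c -> cvgn (pseries c x).
Proof.
case=> [K [C [K0 C1 cKC]]].
have C0 : 0 <= C := le_trans ler01 C1.
apply: normed_cvg.
apply: (@series_le_cvg _ _ (K *: exp_coeff (C * `|x|))) => [n|n|n|] /=.
- exact: normr_ge0.
- by rewrite /= mulr_ge0 ?divr_ge0 ?exprn_ge0 ?mulr_ge0.
- rewrite -[leRHS]/(K * ((C * `|x|) ^+ n / n`!%:R)).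
  rewrite normrM normrX exprMn mulrAC mulrA.
  by rewrite ler_wpM2r ?exprn_ge0.
- exact/is_cvg_seriesZ/is_cvg_series_exp_coeff.
Qed.

Lemma exp_growth_diffs c : exp_growth c -> exp_growth (pseries_diffs c).
Proof.
case=> [K [C [K0 C1 cKC]]].
have C0 : 0 <= C := le_trans ler01 C1.
exists (K * C), C; split=> [||n] //; first by rewrite mulr_ge0.
rewrite /pseries_diffs normrM ger0_norm ?ler0n//.
apply: (le_trans (ler_wpM2l _ (cKC n.+1))); first exact: ler0n.
rewrite factS natrM invfM exprS le_eqVlt; apply/orP; left; apply/eqP.
have n1 : n.+1%:R != 0 :> R by rewrite pnatr_eq0.
have nf : n`!%:R != 0 :> R by rewrite pnatr_eq0 -lt0n fact_gt0.
by field; rewrite nf addrC natr1 n1.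
Qed.

(** The factor [n.+1] supplied by [pseries_diffs] turns [n]![into]n.+1[!], and the extra power of
    [C] costs nothing as [1 <= C]. The term [c 0], invisible to [pseries_diffs], is handled by the
    first hypothesis. *)
Lemma exp_growth_of_diffs c : c 0%N = 0 ->
  exp_growth (pseries_diffs c) -> exp_growth c.
Proof.
move=> c0 [K [C [K0 C1 cKC]]].
have C0 : 0 <= C := le_trans ler01 C1.
exists K, C; split=> // -[|n].
  by rewrite c0 normr0 !mulr_ge0 // invr_ge0.
have n1 : 0 < n.+1%:R :> R by rewrite ltr0n.
rewrite -(ler_pM2l n1) -{1}(ger0_norm (ltW n1)) -normrM.
apply: le_trans (cKC n) _.
rewrite [leRHS]mulrCA ler_wpM2l// factS natrM invfM [leRHS]mulrCA.
rewrite mulVKf ?gt_eqF// exprS -mulrA ler_peMl// divr_ge0 ?exprn_ge0//.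
Qed.

Lemma exp_growth_is_derive c (x : R) : exp_growth c ->
  is_derive x (1 : R) (fun t => limn (pseries c t))
    (limn (pseries (pseries_diffs c) x)).
Proof.
move=> gc; have gc1 := exp_growth_diffs gc; have gc2 := exp_growth_diffs gc1.
(* Termwise differentiation asks for convergence at a point farther out than [x]; any radius above
   the modulus of [x] would do. *)
apply: (@pseries_snd_diffs _ _ (`|x| + 1)); try exact: exp_growth_pseries_cvg.
by rewrite [ltRHS]ger0_norm ?addr_ge0// ltrDl.
Qed.

Lemma limn_pseries0 c : limn (pseries c 0) = c 0%N.
Proof.
apply: lim_near_cst => //.
(* The partial sum of length 0 is empty, so only lengths [m >= 1] are considered. *)
near=> m; rewrite -[m]prednK; last by near: m; exists 1%N.
rewrite /pseries /series /= big_nat_recl//= big1 ?addr0 ?expr0 ?mulr1//.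
by move=> i _; rewrite exprS mul0r mulr0.
Unshelve. all: by end_near. Qed.

End ExponentialGrowth.

(** * Entrywise calculus of matrix curves *)

Section MatrixCurves.
Variable R : realType.

Definition is_mxderive m n (F F' : R -> 'M[R]_(m, n)) :=
  forall t i j, is_derive t (1 : R) (fun s => F s i j) (F' t i j).

Lemma is_mxderive_cst m n (M : 'M[R]_(m, n)) : is_mxderive (fun=> M) (fun=> 0).
Proof. by move=> t i j; rewrite mxE; exact: is_derive_cst. Qed.

Lemma is_mxderiveB m n (F F' G G' : R -> 'M[R]_(m, n)) :
  is_mxderive F F' -> is_mxderive G G' ->
  is_mxderive (fun t => F t - G t) (fun t => F' t - G' t).
Proof.
move=> dF dG t i j; rewrite !mxE.
have := is_deriveB (dF t i j) (dG t i j).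
by congr is_derive; apply/funext => s; rewrite !mxE.
Qed.

Lemma is_mxderiveM m n p (F F' : R -> 'M[R]_(m, n)) (G G' : R -> 'M[R]_(n, p)) :
  is_mxderive F F' -> is_mxderive G G' ->
  is_mxderive (fun t => F t *m G t) (fun t => F' t *m G t + F t *m G' t).
Proof.
move=> dF dG t i j.
have := is_derive_sum (fun k => is_deriveM (dF t i k) (dG t k j)).
congr is_derive.
  by apply/funext => s; rewrite fct_sumE !mxE.
rewrite !mxE -big_split; apply: eq_bigr => k _ /=.
by rewrite addrC; congr (_ + _); rewrite /GRing.scale /= mulrC.
Qed.

Lemma is_mxderive_tr m n (F F' : R -> 'M[R]_(m, n)) :
  is_mxderive F F' -> is_mxderive (fun t => (F t)^T) (fun t => (F' t)^T).
Proof.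
move=> dF t i j; rewrite mxE.
by have := dF t j i; congr is_derive; apply/funext => s; rewrite mxE.
Qed.

Lemma is_mxderive_0_cst m n (F F' : R -> 'M[R]_(m, n)) t :
  is_mxderive F F' -> (forall s, F' s = 0) -> F t = F 0.
Proof.
move=> dF F0; apply/matrixP => i j.
apply: (@is_derive_0_is_cst _ (fun s => F s i j)) => s.
by have := dF s i j; rewrite F0 mxE.
Qed.

(** Boxes of entry neighbourhoods form a base at [M], and a filter is closed under the finite
    intersection over all entries. *)
Lemma cvg_mx (T : Type) (F : set_system T) (FF : Filter F) m n
    (f : T -> 'M[R]_(m, n)) (M : 'M[R]_(m, n)) :
  (forall i j, f t i j @[t --> F] --> M i j) -> f t @[t --> F] --> M.
Proof.
move=> fM A [P nP PA]; apply: filterS PA _.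
by apply: filter_forall => i; apply: filter_forall => j; exact/fM/nP.
Qed.

Lemma oint_FTC (f f' F : R -> R) (a b : R) :
  (forall t : R, is_derive t (1 : R) f (f' t)) -> (forall t : R, is_derive t (1 : R) F (f t)) ->
  oint a b f = F b - F a.
Proof.
move=> df dF.
have cts (g g' : R -> R) : (forall t : R, is_derive t (1 : R) g (g' t)) -> continuous g.
  by move=> dg t; apply/differentiable_continuous/derivable1_diffP.
have ftc x y : x < y -> \int[lebesgue_measure]_(t in `[x, y]) f t = F y - F x.
  move=> xy; rewrite /Rintegral (@continuous_FTC2 _ f F)//.
  - exact/continuous_subspaceT/(cts _ _ df).
  - split=> [t _||]; first by case: (dF t).
    + exact/cvg_at_right_filter/(cts _ _ dF).
    + exact/cvg_at_left_filter/(cts _ _ dF).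
  - by move=> t _; rewrite derive1E; case: (dF t).
rewrite /oint; case: ltgtP => [/ftc->//|/ftc->|->]; first by rewrite opprB.
by rewrite set_itv1 Rintegral_set1 subrr.
Qed.

End MatrixCurves.

(** * The matrix exponential and its integral as power series in time *)

Section MatrixExponential.
Variables (R : realType) (d : nat) (A : 'M[R]_d).

Definition exp_entry_coeff i j : R^nat := fun n => (n`!%:R)^-1 * (A ^+ n) i j.

Lemma exp_entry_coeff_growth i j : exp_growth (exp_entry_coeff i j).
Proof.
(* [N] bounds every absolute row sum of [A], so the entries of [A ^+ n] are at most [(1 + N) ^+ n];
   the added 1 secures [1 <= C]. *)
pose N := \sum_i \sum_j `|A i j|.
have N0 : 0 <= N by rewrite sumr_ge0// => ? _; exact: sumr_ge0.
have rowN k : \sum_l `|A k l| <= N.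
  by rewrite /N [leRHS](bigD1 k)//= lerDl sumr_ge0// => ? _; exact: sumr_ge0.
have powN n k l : `|(A ^+ n) k l| <= (1 + N) ^+ n.
  elim: n k l => [|n IH] k l.
    by rewrite !expr0 mxE; case: eqP; rewrite ?normr1 ?normr0.
  rewrite exprS mxE (le_trans (ler_norm_sum _ _ _))//.
  apply: (@le_trans _ _ (\sum_m `|A k m| * (1 + N) ^+ n)).
    by apply: ler_sum => m _; rewrite normrM ler_wpM2l.
  rewrite -mulr_suml exprS ler_wpM2r ?exprn_ge0 ?addr_ge0//.
  by rewrite (le_trans (rowN k))// lerDr.
exists 1, (1 + N); split=> [||n]; rewrite ?lerDl//.
rewrite /exp_entry_coeff normrM mul1r mulrC normfV [`|_%:R|]ger0_norm//.
by rewrite ler_wpM2r ?invr_ge0.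
Qed.

Lemma expmx_entry t i j :
  expmx (t *: A) i j = limn (pseries (exp_entry_coeff i j) t).
Proof.
suff -> : expmx (t *: A) =
    \matrix_(i, j) limn (pseries (exp_entry_coeff i j) t) by rewrite mxE.
apply: cvg_lim => //; apply: cvg_mx => {}i {}j; rewrite mxE.
have -> : (fun n => series (fun n => (n`!%:R)^-1 *: (t *: A) ^+ n) n i j) =
    pseries (exp_entry_coeff i j) t.
  apply/funext => n; rewrite /pseries /series /= summxE.
  apply: eq_bigr => k _; rewrite mxE /exp_entry_coeff -mulrA; congr (_ * _).
  elim: k i j => [|k IH] i j; first by rewrite !expr0 mulr1.
  rewrite !exprS !mxE mulr_suml; apply: eq_bigr => l _.
  by rewrite IH mxE; ring.
exact/exp_growth_pseries_cvg/exp_entry_coeff_growth.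
Qed.

Lemma expmx0 : expmx (0 *: A) = 1%:M.
Proof.
apply/matrixP => i j; rewrite expmx_entry limn_pseries0.
by rewrite /exp_entry_coeff fact0 invr1 mul1r expr0.
Qed.

Lemma expmx_is_mxderive :
  is_mxderive (fun t => expmx (t *: A)) (fun t => A *m expmx (t *: A)).
Proof.
move=> t i j.
have /= := @exp_growth_is_derive _ _ t (exp_entry_coeff_growth i j).
congr is_derive; first by apply/funext => s; rewrite expmx_entry.
apply: cvg_lim => //.
(* Differentiation cancels [n.+1] in the factorial, and [A ^+ n.+1 = A * A ^+ n] splits off row [i]
   of [A]. *)
have -> : pseries (pseries_diffs (exp_entry_coeff i j)) t =
    fun n => \sum_k A i k * pseries (exp_entry_coeff k j) t n.
  apply/funext => n; rewrite /pseries /series /=.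
  under [RHS]eq_bigr do rewrite mulr_sumr.
  rewrite exchange_big; apply: eq_bigr => m _ /=.
  rewrite /pseries_diffs /exp_entry_coeff factS natrM invfM exprS mxE.
  rewrite !mulrA divff ?pnatr_eq0// mul1r mulr_sumr mulr_suml.
  by apply: eq_bigr => k _; ring.
rewrite mxE; under [X in _ --> X]eq_bigr do rewrite expmx_entry.
apply: cvg_big => [|k _]; first exact: add_continuous.
by apply: cvgMl_tmp; exact/exp_growth_pseries_cvg/exp_entry_coeff_growth.
Qed.

Lemma ointmx_expmx_is_mxderive :
  is_mxderive (fun t => ointmx 0 t (fun s => expmx (s *: A)))
    (fun t => expmx (t *: A)).
Proof.
move=> t i j.
(* Termwise antiderivative with constant term 0: its sum vanishes at 0, so the fundamental theorem
   identifies it with the integral. *)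
pose c n := if n is m.+1 then exp_entry_coeff i j m / m.+1%:R else 0.
have dc : pseries_diffs c = exp_entry_coeff i j.
  by apply/funext => n; rewrite /pseries_diffs /= mulrC divfK// pnatr_eq0.
have gc : exp_growth c.
  by apply: exp_growth_of_diffs => //; rewrite dc; exact: exp_entry_coeff_growth.
have dP s : is_derive s (1 : R) (fun t => limn (pseries c t)) (expmx (s *: A) i j).
  by rewrite expmx_entry -dc; exact: exp_growth_is_derive.
have := dP t; congr is_derive; apply/funext => s; rewrite mxE.
rewrite (oint_FTC 0 s (fun r => expmx_is_mxderive r i j) dP).
by rewrite limn_pseries0 subr0.
Qed.

Lemma ointmx_expmx0 : ointmx 0 0 (fun s => expmx (s *: A)) = 0.
Proof.
by apply/matrixP => i j; rewrite !mxE /oint lexx set_itv1 Rintegral_set1.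
Qed.

End MatrixExponential.

(** * Algebraic identities for the flow and its integral *)

(* The exponential and its integral enter only through their ODEs. *)
Section Flow.
Variables (R : realType) (d : nat) (A : 'M[R]_d).
Variables E P : R -> 'M[R]_d.
Hypotheses (dE : is_mxderive E (fun t => A *m E t)) (E0 : E 0 = 1%:M).
Hypotheses (dP : is_mxderive P E) (P0 : P 0 = 0).

Lemma mulmx_flow_int t : A *m P t = E t - 1%:M.
Proof.
have dX := is_mxderiveB (is_mxderiveM (is_mxderive_cst A) dP) dE.
have := is_mxderive_0_cst t dX.
rewrite E0 P0 mulmx0 sub0r => X0.
rewrite -[LHS](subrK (E t)) X0 1?addrC// => s.
by rewrite mul0mx add0r subrr.
Qed.

Hypothesis skewA : A^T = - A.

(** The derivative of the left side is [E^T (A^T B + B A) E], which is zero as [A^T = - A]. Taking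
    [B = 1] gives orthogonality; general [B] then gives commutation. *)
Lemma skew_flow_conj (B : 'M[R]_d) t :
  A *m B = B *m A -> (E t)^T *m B *m E t = B.
Proof.
move=> AB.
have dX := is_mxderiveM (is_mxderiveM (is_mxderive_tr dE) (is_mxderive_cst B)) dE.
rewrite (is_mxderive_0_cst t dX) => [|s].
  by rewrite E0 trmx1 mul1mx mulmx1.
by rewrite trmx_mul skewA mulmx0 addr0 !mulmxA -[_ *m B *m A]mulmxA -AB
  mulmxN !mulNmx !mulmxA addNr.
Qed.

Lemma skew_flow_orthogonal t : (E t)^T *m E t = 1%:M.
Proof.
by have := @skew_flow_conj 1%:M t; rewrite !mulmx1 mul1mx; exact.
Qed.

Lemma skew_flow_comm (B : 'M[R]_d) t :
  A *m B = B *m A -> E t *m B = B *m E t.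
Proof.
move=> AB; rewrite -[in LHS](skew_flow_conj t AB) !mulmxA.
by rewrite (mulmx1C (skew_flow_orthogonal t)) mul1mx.
Qed.

Lemma skew_flow_int_comm (B : 'M[R]_d) t :
  A *m B = B *m A -> P t *m B = B *m P t.
Proof.
move=> AB; apply/eqP; rewrite -subr_eq0; apply/eqP.
have dX := is_mxderiveB (is_mxderiveM dP (is_mxderive_cst B))
  (is_mxderiveM (is_mxderive_cst B) dP).
rewrite (is_mxderive_0_cst t dX) => [|s].
  by rewrite P0 mul0mx mulmx0 subrr.
by rewrite mulmx0 mul0mx addr0 add0r skew_flow_comm ?subrr.
Qed.

(** For the exponential, [P^T] is the integral of [e^{-sA}], so this is the substitution of [t - s]
    for [s]. The proof shows that [E - (A E P^T + E E^T)], the derivative of [P - E P^T],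
    vanishes. *)
Lemma skew_flow_mul_tr_int t : E t *m (P t)^T = P t.
Proof.
have dX := is_mxderiveB dP (is_mxderiveM dE (is_mxderive_tr dP)).
apply/esym/eqP; rewrite -subr_eq0; apply/eqP.
rewrite (is_mxderive_0_cst t dX) => [|s].
  by rewrite P0 trmx0 mulmx0 subrr.
have PA : (P s)^T *m A = 1%:M - (E s)^T.
  apply: (can_inj (@trmxK _ _ _)); rewrite trmx_mul trmxK skewA mulNmx.
  by rewrite mulmx_flow_int opprB raddfB /= trmx1 trmxK.
rewrite -(skew_flow_comm s (erefl (A *m A))) -mulmxA.
have -> : A *m (P s)^T = (P s)^T *m A.
  apply: (can_inj (@trmxK _ _ _)); rewrite !trmx_mul trmxK skewA mulmxN mulNmx.
  by rewrite (skew_flow_int_comm s (erefl (A *m A))).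
by rewrite PA mulmxBr mulmx1 (mulmx1C (skew_flow_orthogonal s)) subrK subrr.
Qed.

End Flow.

(** * Quadratic forms and the energy balance of one step *)

Lemma skew_quad0 (R : numDomainType) (d : nat) (N : 'M[R]_d) (w : 'cV[R]_d) :
  N^T = - N -> (w^T *m N *m w) 0 0 = 0.
Proof.
move=> skewN; have : (w^T *m N *m w)^T 0 0 = - (w^T *m N *m w) 0 0.
  by rewrite !trmx_mul trmxK skewN mulmxA mulmxN mulNmx mxE.
by rewrite mxE => /eqP; rewrite -addr_eq0 -mulr2n mulrn_eq0 => /eqP.
Qed.

Lemma quadD (R : comNzRingType) (d : nat) (D : 'M[R]_d) (x z : 'cV[R]_d) :
  D^T = D -> ((x + z)^T *m D *m (x + z)) 0 0 =
    (x^T *m D *m x) 0 0 + ((D *m x)^T *m z) 0 0 *+ 2 + (z^T *m D *m z) 0 0.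
Proof.
move=> hD.
have zDx : z^T *m D *m x = (x^T *m D *m z)^T.
  by rewrite !trmx_mul trmxK hD mulmxA.
rewrite [(x + z)^T]raddfD /= !(mulmxDl, mulmxDr) zDx (trmx_mul D) hD.
move: (x^T *m D *m x) (x^T *m D *m z) (z^T *m D *m z) => a b c.
by rewrite !mxE; ring.
Qed.

Theorem theorem3 (R : realType) (d : nat) (J D : 'M[R]_d)
    (hJ : J^T = - J) (hD : D^T = D) (hJD : J *m D = D *m J)
    (V : 'cV[R]_d -> R) (hV : forall q : 'cV[R]_d, differentiable V q)
    (dgV : 'cV[R]_d -> 'cV[R]_d -> 'cV[R]_d)
    (hdgV : discrete_gradient V dgV) :
  let A := J *m D in
  let H := hamiltonian D V in
  forall (h : R) (qk qk1 : 'cV[R]_d),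
    qk1 = expmx (h *: A) *m qk
          + ointmx 0 h (fun tau : R => expmx (tau *: A)) *m J *m dgV qk qk1 ->
    H qk1 = H qk.
Proof.
move=> A H h x y; rewrite /H /hamiltonian.
set E := expmx _; set P := ointmx _ _ _; set g := dgV x y => yE.
have skewA : A^T = - A by rewrite /A trmx_mul hJ hD mulmxN hJD.
have AJ : A *m J = J *m A by rewrite /A -mulmxA -hJD.
have dE := expmx_is_mxderive A; have E0 := expmx0 A.
have dP := ointmx_expmx_is_mxderive A; have P0 := ointmx_expmx0 A.
have AP : A *m P = E - 1%:M := mulmx_flow_int dE E0 dP P0 h.
have commP := skew_flow_int_comm dE E0 dP P0 skewA h.
have PA : P *m A = A *m P := commP _ (erefl (A *m A)).
have PJ : P *m J = J *m P := commP _ AJ.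
have EtE : E^T *m E = 1%:M := skew_flow_orthogonal dE E0 skewA h.
have EPt : E *m P^T = P := skew_flow_mul_tr_int dE E0 dP P0 skewA h.
clearbody E P.
have [w wE] : exists w, w = D *m x + g by eexists.
have [z zE] : exists z, z = P *m J *m w by eexists.
(* [P J D x = P A x = A P x = (E - 1) x], so [z] absorbs the linear part of the scheme. *)
have yz : y = x + z.
  rewrite zE wE mulmxDr addrA -[in LHS]/g yE; congr (_ + _).
  by rewrite mulmxA -(mulmxA P J D) PA AP mulmxBl mul1mx addrC subrK.
have Vy : V y - V x = (g^T *m z) 0 0.
  have -> : z = y - x by rewrite yz addrAC subrr add0r.
  by rewrite -(hdgV x y) /dotv mxE; apply: eq_bigr => i _; rewrite [g^T _ _]mxE.
have PtJ : P^T *m J = J *m P^T.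
  apply: (can_inj (@trmxK _ _ _)).
  by rewrite !trmx_mul trmxK hJ mulNmx mulmxN PJ.
have PtE : P^T *m E = P.
  by rewrite -[in LHS]EPt trmx_mul trmxK -mulmxA EtE mulmx1.
(* Moving [J] past [P^T] forms [J D = A], and [P^T A P = P^T (E - 1) = P - P^T]; the sign comes from
   [J^T = - J]. *)
have PDP : (P *m J)^T *m D *m (P *m J) = (P^T - P) *m J.
  rewrite trmx_mul hJ mulNmx -PtJ !mulNmx -!mulmxA (mulmxA J D) -/A.
  by rewrite (mulmxA A) AP mulmxA mulmxBr PtE mulmx1 -mulNmx opprB.
have quad0 : (w^T *m ((P + P^T) *m J) *m w) 0 0 = 0.
  apply: skew_quad0.
  by rewrite trmx_mul hJ raddfD /= trmxK mulNmx mulmxDr -PJ -PtJ mulmxDl addrC.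
have key : z^T *m D *m z + (w^T *m z) *+ 2 = w^T *m ((P + P^T) *m J) *m w.
  have -> : (P + P^T) *m J = (P *m J)^T *m D *m (P *m J) + (P *m J) *+ 2.
    by rewrite PDP mulmxDl mulmxBl mulr2n addrA subrK addrC.
  rewrite mulmxDr mulmxDl mulr2n mulmxDr mulmxDl -mulr2n.
  by rewrite zE (trmx_mul (P *m J)) !mulmxA.
have {}key : (z^T *m D *m z) 0 0 + (w^T *m z) 0 0 *+ 2 = 0.
  by rewrite -quad0 -key !(mxE, mulr2n).
(* The [g] part of [w] yields the potential increment by the discrete gradient property; the [D x]
   part is the cross term in [quadD]. *)
have wz : (w^T *m z) 0 0 = ((D *m x)^T *m z) 0 0 + (V y - V x).
  by rewrite Vy wE raddfD /= mulmxDl mxE.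
rewrite {1 2}yz quadD//.
have -> : (z^T *m D *m z) 0 0 = - (w^T *m z) 0 0 *+ 2.
  by apply/eqP; rewrite mulNrn -addr_eq0 key.
by rewrite wz; field.
Qed.
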